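(* For every odd $n\geq 3$, the graph $B_n$ admits a drawing in which both the set of vertices and the set of midpoints of edges are strictly convex, i.e., $B_n\in\mathcal{G}_s^s$. Consequently, $g_s^s(n)\geq\lfloor\frac{3}{2}(n-1)\rfloor$.
   Context: For odd $n\geq 3$, $B_n$ is the graph obtained by taking a triangle $C_3$ and $\frac{n-3}{2}$ copies of the $4$-cycle $C_4$ and identifying all of them along a single common edge $uv$; it has $n$ vertices and $\frac{3}{2}(n-1)$ edges. A finite point set $X\subseteq\mathbb{R}^2$ is strictly convex if every point of $X$ is a vertex of its convex hull. A drawing of a graph is a map of its vertices to $\mathbb{R}^2$, edges drawn as straight segments, such that no two vertices coincide, no two edge midpoints coincide, and no edge midpoint coincides with a vertex. $\mathcal{G}_s^s$ is the class of graphs admitting a drawing whose vertex set and edge-midpoint set are both strictly convex; $g_s^s(n)$ is the maximum number of edges of an $n$-vertex graph in $\mathcal{G}_s^s$. *)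

(* Defs.v *)
From HB Require Import structures.
From mathcomp Require Import all_boot all_order all_algebra.
From mathcomp Require Import boolp classical_sets reals convex.

Set Implicit Arguments.
Unset Strict Implicit.
Unset Printing Implicit Defensive.

Import Order.TTheory GRing.Theory Num.Theory.
Local Open Scope classical_set_scope.
Local Open Scope ring_scope.

Section StrictConvexity.
Variable R : realType.

Definition convex_hull (X : set 'rV[R]_2) : set 'rV[R]_2 :=
  smallest (@convex_set R 'rV[R]_2) X.

(* A vertex is a zero-dimensional face: some linear form attains its maximum
   over P at v and nowhere else. *)
Definition is_vertex (P : set 'rV[R]_2) (v : 'rV[R]_2) : Prop :=
  P v /\ exists c : 'cV[R]_2,
    forall x, P x -> x <> v -> (x *m c) 0 0 < (v *m c) 0 0.

Definition strictly_convex (X : set 'rV[R]_2) : Prop :=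
  forall v, X v -> is_vertex (convex_hull X) v.

End StrictConvexity.

Section Drawings.
Variables (R : realType) (V : finType).
Implicit Types (E : {set {set V}}) (p : V -> 'rV[R]_2).

(* A finite simple graph on the vertex type V is given by its set E of edges,
   each of them an unordered pair of distinct vertices. *)
Definition simple_graph E : Prop := forall e, e \in E -> #|e| = 2%N.

(* Only used for sets e of cardinal 2. *)
Definition midpoint p (e : {set V}) : 'rV[R]_2 := 2^-1 *: \sum_(x in e) p x.

Record is_drawing E p : Prop := IsDrawing {
  drawing_vertices : injective p;
  drawing_midpoints : {in E &, injective (midpoint p)};
  drawing_disjoint : forall e x, e \in E -> midpoint p e <> p x
}.

Definition in_Gss E : Prop :=
  simple_graph E /\
  exists p, [/\ is_drawing E p,
                strictly_convex (range p) &
                strictly_convex (midpoint p @` [set` E])].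

End Drawings.

Definition gss (R : realType) (n : nat) : nat :=
  \max_(E : {set {set 'I_n}} | `[< in_Gss R E >]) #|E|.

(* u = 0, v = 1, the third vertex of the triangle is 2, and the i-th 4-cycle
   is u, v, 2i + 4, 2i + 3; all these cycles contain the edge {u, v}. *)
Definition B_cycles (n : nat) : seq (seq nat) :=
  [:: 0; 1; 2]%N :: [seq [:: 0; 1; i.*2 + 4; i.*2 + 3]%N | i <- iota 0 (n - 3)./2].

Definition B_step (n : nat) : rel nat :=
  fun x y => has (fun c => (x \in c) && (y == next c x)) (B_cycles n).

Definition B (n : nat) : {set {set 'I_n}} :=
  [set e : {set 'I_n} | [exists x : 'I_n, exists y : 'I_n,
                           (e == [set x; y]%SET) && B_step n x y]]%SET.

(* Main.v *)
(* Draw u = (-1, 0), v = (1, 0), w = (0, 7), and put the other two vertices of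
   each 4-cycle on two short parabolic arcs, at a(t) = (-1 + t, 4 + 6t - t^2)
   and b(t) = (1 + t, 4 - 6t - t^2), with a different small t > 0 for each cycle.
   For t = 0 the points u, v, b, w, a form a convex pentagon, and the sums
   u+v, v+b, v+w, a+b, u+w, u+a form a convex hexagon.  For small t the sums
   u+a(t), v+b(t) and a(t)+b(t) = (2t, 8 - 2t^2) also run along concave
   parabolas, whose tangents at a point separate it from all the other points.
   Every initial segment of the vertices of the union of all the B_n is drawn in
   this way; it spans floor(3(n-1)/2) edges, whatever the parity of n. *)
Require Import Defs.
From mathcomp Require Import all_boot all_order all_algebra.
From mathcomp Require Import boolp classical_sets reals convex interval_inference.
From mathcomp Require Import zify lra.

Set Implicit Arguments.
Unset Strict Implicit.
Unset Printing Implicit Defensive.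

Import Order.TTheory GRing.Theory Num.Theory.

Section Exposed.
Local Open Scope classical_set_scope.
Local Open Scope ring_scope.

(** Stated for an indexed family instead of its image, so that exposure yields injectivity as well
    as strict convexity. *)
Definition exposed (R : realType) (I : Type) (D : set I) (f : I -> 'rV[R]_2) :=
  forall i, D i -> exists c : 'cV[R]_2,
    forall j, D j -> j <> i -> (f j *m c) 0 0 < (f i *m c) 0 0.

Lemma exposed_inj (R : realType) (I : Type) (D : set I) (f : I -> 'rV[R]_2) i j :
  exposed D f -> D i -> D j -> f i = f j -> i = j.
Proof.
move=> ef Di Dj fij; have [//|nij] := pselect (i = j).
by have [c /(_ _ Di nij)] := ef _ Dj; rewrite fij ltxx.
Qed.

Lemma exposed_strictly_convex (R : realType) (I : Type) (D : set I)
    (f : I -> 'rV[R]_2) :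
  exposed D f -> strictly_convex (f @` D).
Proof.
move=> ef _ [i Di <-]; split; first by apply: sub_gen_smallest; exists i.
have [c hc] := ef i Di; exists c => x hx xi.
(* A proper convex combination of points of [A] is either [f i] or strictly lower under [c], so [A]
   is convex; it contains the family, hence the hull. *)
pose A := [set y : 'rV[R]_2 | y = f i \/ (y *m c) 0 0 < (f i *m c) 0 0].
suff /(_ x hx) :  convex_hull (f @` D) `<=` A by case.
apply: smallest_sub; last first.
  move=> _ [j Dj <-]; have [->|nij] := pselect (j = i); first by left.
  by right; apply: hc.
apply/convex_setW => y z; rewrite !inE => Ay Az k k0 k1; rewrite inE /=.
change (conv k y z) with (k%:num *: y + (1 - k%:num) *: z : 'rV[R]_2).
move: k%:num k0 k1 => {}k k0 k1.
have dotE : ((k *: y + (1 - k) *: z) *m c) 0 0 =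
    k * (y *m c) 0 0 + (1 - k) * (z *m c) 0 0.
  by rewrite mulmxDl -!scalemxAl !mxE.
case: Ay Az dotE => [->|ltyi] [->|ltzi] dotE.
- by left; rewrite -scalerDl addrC subrK scale1r.
- by right; rewrite dotE; nra.
- by right; rewrite dotE; nra.
- by right; rewrite dotE; nra.
Qed.

Lemma midpoint_set2 (R : realType) (V : finType) (p : V -> 'rV[R]_2) x y :
  x != y -> midpoint p [set x; y]%SET = 2^-1 *: (p x + p y).
Proof. by move=> xy; rewrite /midpoint big_setU1 ?inE //= big_set1. Qed.

Lemma midpoint_dot (R : realType) (V : finType) (p : V -> 'rV[R]_2) (c : 'cV[R]_2) x y :
  x != y -> (midpoint p [set x; y]%SET *m c) 0 0 =
            2^-1 * ((p x *m c) 0 0 + (p y *m c) 0 0).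
Proof.
by move=> xy; rewrite midpoint_set2 // -scalemxAl mulmxDl !mxE.
Qed.

(** A form peaking only at one vertex also keeps midpoints away from it: its average over two
    distinct vertices stays below the peak. *)
Lemma exposed_in_Gss (R : realType) (V : finType) (E : {set {set V}})
    (p : V -> 'rV[R]_2) :
  simple_graph E -> exposed setT p -> exposed [set` E] (midpoint p) ->
  in_Gss R E.
Proof.
move=> sE ep em; split=> //; exists p; split; last 2 first.
- exact: exposed_strictly_convex.
- exact: exposed_strictly_convex.
split.
- by move=> x y; apply: exposed_inj ep _ _.
- by move=> e e' eE e'E; apply: exposed_inj em _ _.
- move=> e z eE; have /eqP/cards2P[x [y [xy ->]]] := sE _ eE.
  have [c hc] := ep z Logic.I => mz.
  have := midpoint_dot p c xy; rewrite mz.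
  have le t : (p t *m c) 0 0 <= (p z *m c) 0 0.
    by have [->//|/eqP tz] := eqVneq t z; exact/ltW/hc.
  have [xz|/eqP xz] := eqVneq x z.
    have yz : y <> z by move=> yz; rewrite xz yz eqxx in xy.
    by have := hc y Logic.I yz; have := le x; lra.
  by have := hc x Logic.I xz; have := le y; lra.
Qed.

Definition vec (R : realType) (q : R * R) : 'rV[R]_2 :=
  \row_j (if j == 0 then q.1 else q.2).

Lemma vec_dot (R : realType) (q c : R * R) :
  (vec q *m (vec c)^T) 0 0 = q.1 * c.1 + q.2 * c.2.
Proof. by rewrite mxE big_ord_recl big_ord1 !mxE. Qed.

End Exposed.

(* An enumeration of the edges of the union of all the B_n: the edges from a
   vertex to smaller ones come in blocks of three, for the vertices 2q+1, 2q+2. *)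
Definition edge_ends (k : nat) : nat * nat :=
  let q := k %/ 3 in
  match k %% 3 with
  | 0 => (0, q.*2.+1)
  | 1 => (1, q.*2.+2)
  | _ => (if q is 0 then 0 else q.*2.+1, q.*2.+2)
  end.

Lemma edge_ends_lt k : ((edge_ends k).1 < (edge_ends k).2).
Proof.
by rewrite /edge_ends; case: (k %/ 3) => [|i]; case: (k %% 3) => [|[|r]] /=; lia.
Qed.

Lemma edge_ends_inj : injective edge_ends.
Proof.
move=> k l; rewrite /edge_ends.
have := ltn_pmod k (isT : 0 < 3); have := ltn_pmod l (isT : 0 < 3).
have := divn_eq k 3; have := divn_eq l 3.
case: (k %/ 3) (k %% 3) => [|i] [|[|[|//]]];
  case: (l %/ 3) (l %% 3) => [|j] [|[|[|//]]] -> -> _ _ //= [] *; lia.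
Qed.

(** Holds for [B n] and for the edge set behind the bound on [gss], so one drawing serves both
    halves of the theorem. *)
Definition has_edge_ends n (E : {set {set 'I_n}}) := forall e, e \in E ->
  exists k (x y : 'I_n), e = [set x; y] /\ edge_ends k = (x : nat, y : nat).

Section Drawing.
Variable R : realType.
Local Open Scope ring_scope.

Definition param (i : nat) : R := (10 * i.+1%:R)^-1.

Lemma param_gt0 i : 0 < param i.
Proof. by rewrite invr_gt0 mulr_gt0. Qed.

Lemma param_le i : param i <= 10^-1.
Proof.
by rewrite lef_pV2 ?posrE ?mulr_gt0 // ler_peMr // ler1n.
Qed.

Lemma param_inj : injective param.
Proof.
have ten0 : 10 != 0 :> R by rewrite pnatr_eq0.
by move=> i j /invr_inj/(mulfI ten0)/eqP; rewrite eqr_nat => /eqP[].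
Qed.

Definition point (x : nat) : R * R :=
  match x with
  | 0 => (-1, 0)
  | 1 => (1, 0)
  | 2 => (0, 7)
  | y.+3 => let t := param y./2 in
            if odd y then (1 + t, 4 - 6 * t - t ^+ 2)
            else (-1 + t, 4 + 6 * t - t ^+ 2)
  end.

(** Bounds the quadratic monomials, so that [lra], taking them as atoms, can compare points on
    different arcs. *)
Lemma param_bounds i j :
  [/\ 0 < param i <= 10^-1, 0 <= param i ^+ 2 <= 100^-1
    & 0 <= param i * param j <= 100^-1].
Proof.
have := (param_gt0 i, param_le i, param_gt0 j, param_le j).
by move=> [[[? ?] ?] ?]; split; nra.
Qed.

Lemma param_sub_sqr i j : i <> j -> 0 < (param i - param j) ^+ 2.
Proof.
by move=> ij; rewrite exprn_even_gt0 //= subr_eq0; apply/eqP => /param_inj.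
Qed.

Lemma point_exposed (x : nat) : exists c : R * R, forall y, y <> x ->
  (point y).1 * c.1 + (point y).2 * c.2 < (point x).1 * c.1 + (point x).2 * c.2.
Proof.
(* On the arcs, [c] is normal to the parabola at parameter t; the point of the same arc at parameter
   s then falls short by exactly (s - t)^2. *)
pose c : R * R := match x with
  | 0 => (-1, -1) | 1 => (1, -1) | 2 => (0, 1)
  | z.+3 => let t := param z./2 in
            if odd z then (6 + 2 * t, 1) else (- (6 - 2 * t), 1)
  end.
exists c => y; rewrite {}/c.
case: x y => [|[|[|x]]] [|[|[|y]]] //= nxy; try lra.
1-3: by have [? ? ?] := param_bounds y./2 0; case: (odd y) => /=; lra.
1-3: by have [? ? ?] := param_bounds x./2 0; case: (odd x) => /=; lra.
have [? ? ?] := param_bounds x./2 y./2; have [? ? ?] := param_bounds y./2 x./2.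
have lt_sq : odd x = odd y -> 0 < (param x./2 - param y./2) ^+ 2.
  move=> oxy; apply: param_sub_sqr => hxy; apply: nxy.
  by rewrite -(odd_double_half x) oxy hxy odd_double_half.
case: (odd x) (odd y) lt_sq => [] [] /= lt_sq.
- have := lt_sq erefl; lra.
- clear lt_sq; lra.
- clear lt_sq; lra.
- have := lt_sq erefl; lra.
Qed.

(** Twice the midpoint, which is exposed by the same forms. *)
Definition edge_sum (k : nat) : R * R :=
  let: (x, y) := edge_ends k in
  ((point x).1 + (point y).1, (point x).2 + (point y).2).

(** In order, u+v, v+w, u+w for the triangle, then u+a, v+b, a+b at [param i]. *)
Definition edge_sum_qr (q r : nat) : R * R :=
  match q, r with
  | 0, 0 => (0, 0)
  | 0, 1 => (1, 7)
  | 0, _ => (-1, 7)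
  | i.+1, 0 => (-2 + param i, 4 + 6 * param i - param i ^+ 2)
  | i.+1, 1 => (2 + param i, 4 - 6 * param i - param i ^+ 2)
  | i.+1, _ => (2 * param i, 8 - 2 * param i ^+ 2)
  end.

Lemma edge_sumE k : edge_sum k = edge_sum_qr (k %/ 3)%N (k %% 3)%N.
Proof.
rewrite /edge_sum /edge_ends.
have := ltn_pmod k (isT : 0 < 3)%N.
case: (k %/ 3)%N => [|i]; case: (k %% 3)%N => [|[|[|//]]] _ /=;
  rewrite ?odd_double ?doubleK ?uphalf_double /=; congr pair; lra.
Qed.

Lemma edge_sum_exposed (k : nat) : exists c : R * R, forall l, l <> k ->
  (edge_sum l).1 * c.1 + (edge_sum l).2 * c.2 <
  (edge_sum k).1 * c.1 + (edge_sum k).2 * c.2.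
Proof.
(* The first three directions expose corners of the hexagon; the others are normals to the three
   parabolas of sums. *)
pose c : R * R := match (k %/ 3)%N, (k %% 3)%N with
  | 0, 0 => (0, -1) | 0, 1 => (2, 1) | 0, _ => (-2, 1)
  | i.+1, 0 => (- (6 - 2 * param i), 1)
  | i.+1, 1 => (6 + 2 * param i, 1)
  | i.+1, _ => (2 * param i, 1)
  end.
exists c => l nlk; rewrite !edge_sumE {}/c.
have {nlk} : (l %/ 3, l %% 3)%N <> (k %/ 3, k %% 3)%N.
  by move=> [hq hr]; apply: nlk; rewrite (divn_eq l 3) hq hr -divn_eq.
have := ltn_pmod k (isT : 0 < 3)%N; have := ltn_pmod l (isT : 0 < 3)%N.
case: (k %/ 3)%N (k %% 3)%N => [|i] [|[|[|//]]];
  case: (l %/ 3)%N (l %% 3)%N => [|j] [|[|[|//]]] _ _ /= nlk;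
  try (by case: nlk); try lra;
  try (have [? ? ?] := param_bounds i 0; lra);
  try (have [? ? ?] := param_bounds j 0; lra);
  have [? ? ?] := param_bounds i j; have [? ? ?] := param_bounds j i; try lra;
  (* Only pairs on the same parabola remain: the gap is the squared difference of parameters,
     doubled for a+b. *)
  (have := @param_sub_sqr i j (fun ij => nlk (congr1 (fun z => (z.+1, _)) (esym ij)));
   lra).
Qed.

Lemma has_edge_ends_in_Gss n (E : {set {set 'I_n}}) :
  has_edge_ends E -> in_Gss R E.
Proof.
move=> hE; have neq k (x y : 'I_n) : edge_ends k = (x : nat, y : nat) -> x != y.
  by move=> hk; have := edge_ends_lt k; rewrite hk -val_eqE /= => /ltn_eqF ->.
apply: (@exposed_in_Gss _ _ _ (fun x : 'I_n => vec (point x))).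
- by move=> e /hE[k [x [y [-> /neq xy]]]]; rewrite cards2 xy.
- move=> x _; have [c hc] := point_exposed x.
  exists (vec c)^T => y _ yx; rewrite !vec_dot; apply: hc => /val_inj //.
- move=> e /= eE; have [k [x [y [ek hk]]]] := hE _ eE.
  have [c hc] := edge_sum_exposed k.
  exists (vec c)^T => e' /= e'E nee; have [l [x' [y' [el hl]]]] := hE _ e'E.
  have nlk : l <> k.
    move=> lk; move: hl; rewrite lk hk => -[/val_inj xx /val_inj yy].
    by apply: nee; rewrite ek el xx yy.
  rewrite ek el !midpoint_dot ?(neq _ _ _ hk) ?(neq _ _ _ hl) // !vec_dot.
  by have := hc _ nlk; rewrite /edge_sum hk hl /=; lra.
Qed.

End Drawing.

Lemma set2_lt_inj n (x y z w : 'I_n) :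
  x < y -> z < w -> [set x; y] = [set z; w] -> x = z /\ y = w.
Proof.
move=> xy zw eqs.
have := set21 x y; have := set22 x y; rewrite eqs !inE.
by move=> /pred2P[] yE /pred2P[] xE; subst; rewrite ?ltnn // in xy; have := ltn_trans xy zw; rewrite ltnn.
Qed.

Lemma B_has_edge_ends n : has_edge_ends (B n).
Proof.
move=> e; rewrite inE => /existsP[x /existsP[y /andP[/eqP-> xy]]].
(* [next] runs around each cycle, so a step may lead from the larger end to the smaller. *)
suff : exists k, edge_ends k = (x : nat, y : nat) \/ edge_ends k = (y : nat, x : nat).
  by case=> k [] hk; [exists k, x, y|exists k, y, x; rewrite finset.setUC].
case/hasP: xy => c; rewrite inE => /predU1P[->|/mapP[i _ ->]] /andP[];
  rewrite ?addn4 ?addn3 !inE; move=> + /eqP.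
- case/or3P => /eqP-> /= ->.
  + by exists 0; left.
  + by exists 1; left.
  + by exists 2; right.
(* Block [i.+1] of the enumeration holds the three edges other than uv of the 4-cycle of index
   [i]. *)
- have ends3 r : r < 3 -> edge_ends (3 * i.+1 + r) = match r with
      | 0 => (0, i.*2.+3) | 1 => (1, i.*2.+4) | _ => (i.*2.+3, i.*2.+4) end.
    move=> r3; rewrite /edge_ends.
    have -> : (3 * i.+1 + r) %/ 3 = i.+1 by lia.
    have -> : (3 * i.+1 + r) %% 3 = r by lia.
    by case: r r3 => [|[|]].
  case/or4P => /eqP-> /=; rewrite ?eqxx => ->.
  + by exists 0; left.
  + by exists (3 * i.+1 + 1); left; rewrite ends3.
  + by exists (3 * i.+1 + 2); right; rewrite ends3.
  + exists (3 * i.+1 + 0); right; rewrite ends3 //.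
    by rewrite (_ : _ == _ = false) //; lia.
Qed.

Theorem theorem7 (R : realType) :
  (forall n : nat, odd n -> 3 <= n -> in_Gss R (B n)) /\
  (forall n : nat, 0 < n -> (3 * (n - 1)) %/ 2 <= gss R n).
Proof.
split=> [n _ _|[//|n] _]; first exact/has_edge_ends_in_Gss/B_has_edge_ends.
rewrite subn1 /=.
set m := (3 * n) %/ 2.
pose edge (k : 'I_m) : {set 'I_n.+1} :=
  [set inord (edge_ends k).1; inord (edge_ends k).2].
(* [inord] is faithful only below [n.+1]. With k = 3q + r and 2(k+1) <= 3n, the larger end, 2q+1 if
   r = 0 and 2q+2 otherwise, is at most n. *)
have ends_lt (k : 'I_m) : (edge_ends k).2 < n.+1.
  have : k.+1 * 2 <= 3 * n.
    by rewrite (leq_trans _ (leq_divM (3 * n) 2)) // leq_pmul2r.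
  rewrite /edge_ends; have := ltn_pmod k (isT : 0 < 3); have := divn_eq k 3.
  by case: (k %% 3) => [|[|[|//]]]; case: (k %/ 3) => [|q] /= -> *; lia.
have fst_lt (k : 'I_m) : (edge_ends k).1 < n.+1.
  by rewrite (ltn_trans (edge_ends_lt k)).
have edge_inj : injective edge.
  move=> k l /set2_lt_inj[]; rewrite ?inordK ?ends_lt ?fst_lt ?edge_ends_lt //.
  move=> /(congr1 val) /= + /(congr1 val) /=; rewrite !inordK //.
  move=> e1 e2; apply/val_inj/edge_ends_inj.
  by rewrite [LHS]surjective_pairing [RHS]surjective_pairing e1 e2.
have <- : #|[set edge k | k : 'I_m]| = m by rewrite card_imset // card_ord.
apply: leq_bigmax_cond; apply/asboolP/has_edge_ends_in_Gss => _ /imsetP[k _ ->].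
exists k, (inord (edge_ends k).1), (inord (edge_ends k).2); split=> //.
by rewrite /= !inordK // -surjective_pairing.
Qed.
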